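(* Let $n\ge 1$. Every subset $P\subseteq\mathbb{N}^n$ with $\mathbf{0}=(0,\ldots,0)\in P$ is $2$-invariant, i.e., there exists a $2$-invariant game $G$ on $n$ piles whose set of $\mathcal{P}$-positions is exactly $P$.
   Context: $\mathbb{N}=\{0,1,2,\ldots\}$. A position is an $n$-tuple $\mathbf{p}\in\mathbb{N}^n$; a move is a non-zero $n$-tuple $\mathbf{m}\in\mathbb{N}^n$, applicable at $\mathbf{p}$ when $\mathbf{m}\le\mathbf{p}$ componentwise, leading to $\mathbf{p}-\mathbf{m}$. A game is a map $G:\mathbb{N}^n\to 2^{\mathbb{N}^n}$ giving for each position the set of allowed moves. For $t\ge1$, $G$ is $t$-invariant if $\mathbb{N}^n$ can be partitioned into sets $S_1,\ldots,S_t$ and there are sets $I_1,\ldots,I_t\subseteq\mathbb{N}^n$ such that for every position $\mathbf{p}\in S_j$, $G(\mathbf{p})=I_j\cap\{\mathbf{m}\in\mathbb{N}^n:\mathbf{m}\le\mathbf{p}\}$. Play is alternating, normal convention (the player making the last move wins). The set $\mathcal{P}(G)$ of $\mathcal{P}$-positions is the set of positions from which the player who is about to move has no winning strategy; equivalently, it is the unique set such that no allowed move leads from an element of it to an element of it, and from every position not in it some allowed move leads into it. A subset $X\subseteq\mathbb{N}^n$ is $t$-invariant if $X=\mathcal{P}(G)$ for some $t$-invariant game $G$. *)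

(* Defs.v *)
From mathcomp Require Import all_boot.
From mathcomp Require Import boolp classical_sets.

Set Implicit Arguments.
Unset Strict Implicit.
Unset Printing Implicit Defensive.

Local Open Scope classical_set_scope.

Definition position (n : nat) := {ffun 'I_n -> nat}.

Definition pos0 (n : nat) : position n := [ffun=> 0].

Definition le_pos (n : nat) (m p : position n) : Prop := forall i, m i <= p i.

(* Componentwise truncated subtraction; only meaningful when [le_pos m p]. *)
Definition sub_pos (n : nat) (p m : position n) : position n :=
  [ffun i => p i - m i].

Record game (n : nat) := Game {
  allowed :> position n -> set (position n);
  allowed_neq0 : forall p m, allowed p m -> m <> pos0 n;
  allowed_le : forall p m, allowed p m -> le_pos m p
}.

(* The library's [partition] asks for nonempty, pairwise disjoint, covering
   parts. *)
Definition t_invariant_game (n t : nat) (G : game n) : Prop :=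
  exists S I : 'I_t -> set (position n),
    partition [set: 'I_t] S [set: position n] /\
    forall j p, S j p -> G p = I j `&` [set m | le_pos m p].

(* [wins_with G s p]: the player about to move at [p] wins every play in which
   she always plays the move [s q] at the positions [q] where it is her turn.
   In particular [s q] is then an allowed move, so she is never the one who is
   stuck. An inductive definition is adequate since all plays are finite.
   Pitfall: [done] and [//] loop on goals [wins_with G s p], as they try [split]
   repeatedly. *)
Inductive wins_with (n : nat) (G : game n) (s : position n -> position n)
    (p : position n) : Prop :=
  WinsWith of G p (s p)
    & forall m, G (sub_pos p (s p)) m ->
        wins_with G s (sub_pos (sub_pos p (s p)) m).

Definition has_winning_strategy (n : nat) (G : game n) (p : position n) : Prop :=
  exists s, wins_with G s p.

Definition P_positions (n : nat) (G : game n) : set (position n) :=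
  [set p | ~ has_winning_strategy G p].

Definition t_invariant_set (n t : nat) (X : set (position n)) : Prop :=
  exists G : game n, t_invariant_game t G /\ P_positions G = X.

(* Main.v *)
Require Import Defs.
From mathcomp Require Import all_boot.
From mathcomp Require Import boolp classical_sets.

(** From a position outside [P] allow every move that is itself not in [P], and
    from a position in [P] allow none. A position [p] outside [P] is won by
    playing [p] itself, which leads to [0], where no move is allowed. The two
    parts are [P] and its complement, except that the complement is empty when
    [P] is everything; then no move is ever allowed and any partition into two
    parts will do. *)

Local Open Scope classical_set_scope.

Lemma sub_pos_id (n : nat) (p : position n) : sub_pos p p = pos0 n.
Proof. by apply/ffunP => i; rewrite !ffunE subnn. Qed.

Lemma two_part_partition (T : Type) (A : set T) :
  A !=set0 -> ~` A !=set0 ->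
  partition [set: 'I_2] (fun j => if j == ord0 then A else ~` A) [set: T].
Proof.
move=> A0 nA0; split.
- apply/seteqP; split=> // x _; have [Ax|nAx] := pselect (A x).
    by exists ord0.
  by exists ord_max.
- move=> i j _ _ [x] /=.
  case: (unliftP ord0 i) => [i' ->|->]; case: (unliftP ord0 j) => [j' ->|->] //=.
  + by rewrite (ord1 i') (ord1 j').
  + by case.
  + by case.
- by move=> i _; case: ifP.
Qed.

Section ComplementGame.
Variables (n : nat) (P : set (position n)).
Hypothesis P0 : P (pos0 n).

Definition complement_moves (p : position n) : set (position n) :=
  [set m | [/\ ~ P p, ~ P m & le_pos m p]].

(** The zero tuple lies in [P] by [P0], whereas moves are taken outside [P]. *)
Lemma complement_moves_neq0 (p m : position n) :
  complement_moves p m -> m <> pos0 n.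
Proof. by case=> _ Pm _ m0; apply: Pm; rewrite m0. Qed.

Lemma complement_moves_le (p m : position n) :
  complement_moves p m -> le_pos m p.
Proof. by case. Qed.

Definition complement_game : game n :=
  @Game n complement_moves complement_moves_neq0 complement_moves_le.

Lemma P_positions_complement_game : P_positions complement_game = P.
Proof.
apply/seteqP; split=> p /=.
  move=> nowin; apply: contrapT => Pp; apply: nowin; exists id; split.
    by split=> // i.
  by rewrite sub_pos_id => m [].
(* From a position of [P], the first move of any strategy is already illegal. *)
by move=> Pp [s [[]]].
Qed.

(** By the last clause, off [A] the condition [~ P p] follows from [~ P m], so the allowed moves
    depend on [p] only through [le_pos m p]. *)
Lemma exists_splitting_part : 0 < n ->
  exists A : set (position n), [/\ A !=set0, ~` A !=set0, A `<=` P &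
    forall p m, ~ A p -> ~ P m -> ~ P p].
Proof.
move=> n_gt0; have [PT|/existsNP[q Pq]] := pselect (forall p, P p); last first.
  by exists P; split=> //; [exists (pos0 n)|exists q].
exists [set pos0 n]; split.
- by exists (pos0 n).
(* With at least one pile, the all-ones tuple is non-zero. *)
- exists [ffun=> 1] => /ffunP/(_ (Ordinal n_gt0)); by rewrite !ffunE.
- by move=> p _; apply: PT.
- by move=> p m _ /(_ (PT m)).
Qed.

Lemma complement_game_two_invariant :
  0 < n -> t_invariant_game 2 complement_game.
Proof.
move=> /exists_splitting_part[A [A0 nA0 AP nAP]].
exists (fun j => if j == ord0 then A else ~` A).
(* No move on [A], which lies in [P]; elsewhere every tuple outside [P]. *)
exists (fun j => if j == ord0 then set0 else ~` P).
split; first exact: two_part_partition.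
move=> j p; case: ifP => _ Ap; apply/seteqP; split=> m /=.
- by case=> + _ _; move/(_ (AP _ Ap)).
- by case.
- by case.
- by case=> Pm mp; split=> //; apply: nAP Ap Pm.
Qed.

End ComplementGame.

Theorem theorem2p1 (n : nat) (hn : 1 <= n) (P : set (position n))
    (hP : P (pos0 n)) : t_invariant_set 2 P.
Proof.
exists (complement_game n P hP); split.
  exact: complement_game_two_invariant.
exact: P_positions_complement_game.
Qed.
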